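(* Let $G=(X,E)$ be an undirected graph, $X=\{1,\ldots,n\}$, and let $U_2=\mathsf{SWAP}\cdot F$ be a reversible quantum walk on $G$ with unit real $1$-eigenvector $|\phi_0\rangle=\sum_x\sqrt{\pi_x}|x\rangle|\phi^x\rangle$ ($\pi_x\ge0$, $|\phi^x\rangle$ real unit vectors) such that $F^x=2|\phi^x\rangle\langle\phi^x|-I$ for all $x\in X$. Let $P$ be the classical analogue of $U_2$, and assume $P$ is ergodic with all eigenvalues positive. Then for all $z\in X$ and all $\varepsilon\in(0,1)$, \[\mathsf{QHT}_\varepsilon(U_2,|z\rangle|\phi^z\rangle)=\mathsf{QHT}_\varepsilon(P,z)=\sqrt{\mathsf{HT}_\varepsilon(P,z)}.\]
   Context: $\mathcal H(G)=\mathrm{Span}(|x\rangle|y\rangle:(x,y)\in E)$; $\mathsf{SWAP}|x\rangle|y\rangle=|y\rangle|x\rangle$. A quantum walk on $G$ is a unitary $U_2=\mathsf{SWAP}\cdot F$ on a subspace of $\mathcal H(G)$ with $F=\sum_x|x\rangle\langle x|\otimes F^x$ real, having a single $1$-eigenvector $|\phi_0\rangle$; it is reversible if $\mathsf{SWAP}|\phi_0\rangle=|\phi_0\rangle$. The classical analogue is $P=(p_{xy})$, $p_{xy}=\langle y|\phi^x\rangle^2$; it is a reversible Markov chain with stationary distribution $\pi$. Quantum hitting time of an abstract search: for a real unitary $V_2$ with real unit $1$-eigenvector $|\varphi\rangle$ and real unit $|\mu\rangle$, let $U=V_2(I-2|\mu\rangle\langle\mu|)$, $|\tilde\varphi\rangle=|\varphi\rangle-\langle\mu|\varphi\rangle|\mu\rangle$,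 decompose $|\tilde\varphi\rangle=\delta_0|w_0\rangle+\sum_j\delta_j(|w_j^+\rangle+|w_j^-\rangle)+\delta_{-1}|w_{-1}\rangle$ with real coefficients in unit eigenvectors of $U$ (eigenvalues $1$, $-1$, $e^{\pm i\alpha_j}$ with $0<\alpha_j<\pi$, $|w_j^-\rangle=\overline{|w_j^+\rangle}$), let $\mathit{QH}$ take value $1/\alpha_j$ w.p. $2\delta_j^2$, $1/\pi$ w.p. $\delta_{-1}^2$, $0$ otherwise, and $\mathsf{QHT}_\varepsilon(V_2,|\mu\rangle)=\min\{y:\Pr[\mathit{QH}>y]\le\varepsilon\}$. $\mathsf{QHT}_\varepsilon(U_2,|z\rangle|\phi^z\rangle)$ uses $V_2=U_2$, $|\varphi\rangle=|\phi_0\rangle$. $\mathsf{QHT}_\varepsilon(P,z)$ uses, on $\mathbb C^{X\times X}$, $|p_x\rangle=\sum_y\sqrt{p_{xy}}|y\rangle$, $\mathcal A=\mathrm{Span}(|x\rangle|p_x\rangle)$, $V_2=\mathsf{SWAP}\cdot(2\Pi_{\mathcal A}-I)$, $|\varphi\rangle=\sum_x\sqrt{\pi_x}|x\rangle|p_x\rangle$, $|\mu\rangle=|z\rangle|p_z\rangle$. Classical: $P_{-z}$ is $P$ with row/column $z$ removed, $\Pi_{-z}=\mathrm{diag}(\pi_x)_{x\ne z}$, $S_{-z}=\sqrt{\Pi_{-z}}P_{-z}\sqrt{\Pi_{-z}}^{-1}$ with orthonormal eigenvectors $v_j$ and eigenvalues $\cos\theta_j$, $0<\theta_j\le\pi/2$;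 $\sqrt{\pi_{-z}}=\sum_j\nu_jv_j$; $H_z$ equals $1/\theta_j^2$ w.p. $\nu_j^2$ and $0$ w.p. $1-\sum_j\nu_j^2$; $\mathsf{HT}_\varepsilon(P,z)=\min\{y:\Pr[H_z>y]\le\varepsilon\}$. *)

(* Defs.v *)
From mathcomp Require Import all_boot all_order all_algebra.
From mathcomp Require Import reals trigo.
From mathcomp Require Export complex.
Set Implicit Arguments. Unset Strict Implicit. Unset Printing Implicit Defensive.
Import Order.TTheory GRing.Theory Num.Theory.
Local Open Scope ring_scope.
Local Open Scope complex_scope.

Section QWDefs.
Variable R : realType.
Local Notation C := R[i].
Variable n : nat.
(* X = 'I_n.  A vector of C^{X x X} is encoded as an n x n complex matrix v,
   with  v x y = (<x| (x) <y|) v.                                             *)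

Definition toC (r : R) : C := r%:C.

Definition dotC (u v : 'M[C]_n) : C := \sum_x \sum_y (u x y)^* * v x y.
Definition sqnormC (u : 'M[C]_n) : R := complex.Re (dotC u u).

Definition SWAP (v : 'M[C]_n) : 'M[C]_n := v^T.

(* H(G) = Span(|x>|y> : (x,y) in E) *)
Definition in_HG (e : rel 'I_n) (v : 'M[C]_n) : Prop :=
  forall x y, ~~ e x y -> v x y = 0.

Definition subspace (K : 'M[C]_n -> Prop) : Prop :=
  K 0 /\ forall (a : C) u v, K u -> K v -> K (a *: u + v).

(* phi : 'M[R]_n encodes the family (|phi^x>)_x : phi x y = <y|phi^x>.
   F = sum_x |x><x| (x) F^x  with  F^x = 2|phi^x><phi^x| - I.                 *)
Definition Fop (phi : 'M[R]_n) (v : 'M[C]_n) : 'M[C]_n :=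
  \matrix_(x, y) (2 * toC (phi x y) * (\sum_y' toC (phi x y') * v x y') - v x y).

Definition qwalk (phi : 'M[R]_n) (v : 'M[C]_n) : 'M[C]_n := SWAP (Fop phi v).

Definition walk_state (phi : 'M[R]_n) (pi : 'I_n -> R) : 'M[C]_n :=
  \matrix_(x, y) toC (Num.sqrt (pi x) * phi x y).

Definition local_state (phi : 'M[R]_n) (z : 'I_n) : 'M[C]_n :=
  \matrix_(x, y) (if x == z then toC (phi z y) else 0).

Definition classical_analogue (phi : 'M[R]_n) : 'M[R]_n :=
  \matrix_(x, y) (phi x y ^+ 2).

Definition irreducible_chain (P : 'M[R]_n) : Prop :=
  forall x y, exists k : nat, 0 < (P ^+ k) x y.
Definition aperiodic_chain (P : 'M[R]_n) : Prop :=
  forall x (d : nat),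
    (forall k : nat, (0 < k)%N -> 0 < (P ^+ k) x x -> (d %| k)%N) -> d = 1%N.
Definition ergodic (P : 'M[R]_n) : Prop := irreducible_chain P /\ aperiodic_chain P.

(* a finitely supported random variable given by a list of (value, probability) *)
Definition tail_prob (l : seq (R * R)) (y : R) : R := \sum_(p <- l | y < p.1) p.2.

Definition is_min_threshold (T : R -> R) (eps q : R) : Prop :=
  T q <= eps /\ (forall y, T y <= eps -> q <= y).

Definition qdecomp (U : 'M[C]_n -> 'M[C]_n) (v : 'M[C]_n)
    (s : seq C) (w : C -> 'M[C]_n) : Prop :=
  uniq s /\ (forall l, l \in s -> U (w l) = l *: w l) /\ v = \sum_(l <- s) w l.

(* for an eigenvalue l = e^{+-i alpha}, 0 < alpha <= pi, the angle alpha *)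
Definition eig_angle (l : C) : R := acos (complex.Re l).

(* distribution of QH: value 1/alpha with the squared weight of the
   e^{+-i alpha}-components, 1/pi with the squared weight of the (-1)-component,
   and 0 with the remaining probability *)
Definition QH_distr (s : seq C) (w : C -> 'M[C]_n) : seq (R * R) :=
  (0, 1 - \sum_(l <- s | l != 1) sqnormC (w l))
    :: [seq ((eig_angle l)^-1, sqnormC (w l)) | l <- s & l != 1].

(* QHT_eps(V2, |mu>) = q, where |varphi> is the 1-eigenvector of V2;
   U = V2 (I - 2|mu><mu|), varphi~ = varphi - <mu|varphi> mu *)
Definition QHT_is (V2 : 'M[C]_n -> 'M[C]_n) (varphi mu : 'M[C]_n) (eps q : R) : Prop :=
  let U := fun v => V2 (v - (2 * dotC mu v) *: mu) in
  let phit := varphi - dotC mu varphi *: mu in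
  (exists s w, qdecomp U phit s w) /\
  (forall s w, qdecomp U phit s w -> is_min_threshold (tail_prob (QH_distr s w)) eps q).

Definition Avec (P : 'M[R]_n) (x : 'I_n) : 'M[C]_n :=
  \matrix_(x', y) (if x' == x then toC (Num.sqrt (P x y)) else 0).
(* orthogonal projection onto A = Span(|x>|p_x>) (the |x>|p_x> are orthonormal
   when P is stochastic) *)
Definition projA (P : 'M[R]_n) (v : 'M[C]_n) : 'M[C]_n :=
  \sum_x dotC (Avec P x) v *: Avec P x.
Definition V2P (P : 'M[R]_n) (v : 'M[C]_n) : 'M[C]_n :=
  SWAP (2%:R *: projA P v - v).
Definition varphiP (P : 'M[R]_n) (pi : 'I_n -> R) : 'M[C]_n :=
  \sum_x toC (Num.sqrt (pi x)) *: Avec P x.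

Definition QHT_P_is (P : 'M[R]_n) (pi : 'I_n -> R) (z : 'I_n) (eps q : R) : Prop :=
  QHT_is (V2P P) (varphiP P pi) (Avec P z) eps q.

(* P_{-z}, Pi_{-z}, S_{-z}, sqrt(pi_{-z}); X \ {z} is indexed by 'I_n.-1 via lift z *)
Definition P_minus (P : 'M[R]_n) (z : 'I_n) : 'M[R]_n.-1 := row' z (col' z P).
Definition sqrtPi_minus (pi : 'I_n -> R) (z : 'I_n) : 'M[R]_n.-1 :=
  diag_mx (\row_i Num.sqrt (pi (lift z i))).
Definition S_minus (P : 'M[R]_n) (pi : 'I_n -> R) (z : 'I_n) : 'M[R]_n.-1 :=
  sqrtPi_minus pi z *m P_minus P z *m invmx (sqrtPi_minus pi z).
Definition sqrtpi_minus (pi : 'I_n -> R) (z : 'I_n) : 'cV[R]_n.-1 :=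
  \col_i Num.sqrt (pi (lift z i)).

Definition sqnormR (u : 'cV[R]_n.-1) : R := \sum_i u i 0 ^+ 2.

Definition cdecomp (S : 'M[R]_n.-1) (v : 'cV[R]_n.-1)
    (s : seq R) (w : R -> 'cV[R]_n.-1) : Prop :=
  uniq s /\ (forall l, l \in s -> S *m w l = l *: w l) /\ v = \sum_(l <- s) w l.

(* H_z = 1/theta^2 (cos theta = eigenvalue, 0 < theta <= pi/2) with the squared
   weight of the component on that eigenspace, 0 with the remaining probability *)
Definition H_distr (s : seq R) (w : R -> 'cV[R]_n.-1) : seq (R * R) :=
  (0, 1 - \sum_(l <- s) sqnormR (w l))
    :: [seq ((acos l ^+ 2)^-1, sqnormR (w l)) | l <- s].

Definition HT_is (P : 'M[R]_n) (pi : 'I_n -> R) (z : 'I_n) (eps h : R) : Prop :=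
  let S := S_minus P pi z in
  let v := sqrtpi_minus pi z in
  (exists s w, cdecomp S v s w) /\
  (forall s w, cdecomp S v s w -> is_min_threshold (tail_prob (H_distr s w)) eps h).

End QWDefs.

(* Main.v *)
Require Import Defs.
From mathcomp Require Import all_boot all_order all_algebra.
From mathcomp Require Import reals trigo complex.
From mathcomp Require Import sesquilinear spectral ring.
Set Implicit Arguments. Unset Strict Implicit. Unset Printing Implicit Defensive.
Import Order.TTheory GRing.Theory Num.Theory.
Local Open Scope ring_scope.
Local Open Scope complex_scope.

(** Composing the walk with the reflection through [|z>|phi^z>] gives SWAP times
    the reflection about the span of the [|x>|phi^x>], [x != z].  If [f] is an
    eigenvector of [S_{-z}] with eigenvalue [cos theta], extended by [0] at [z], and
    [a = sum_x f_x |x>|phi^x>], the search operator maps [a] to [SWAP a] and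
    [SWAP a] to [2 cos theta SWAP a - a].  Hence [a] splits into two eigenvectors,
    of eigenvalues [e^(+-i theta)] and equal squared norms [|f|^2 / 2], and [QH]
    is distributed as the square root of [H_z].  A maximum principle gives
    [|cos theta| < 1].  The walk defined from [P] is the same construction with
    [|phi x y|] in place of [phi x y], and reversibility makes both have the same
    [S_{-z}]. *)

(** * Eigenvector decompositions: uniqueness, and existence for real symmetric matrices *)

Lemma eigen_sum_eq0 (F : fieldType) (V : lmodType F) (U : V -> V)
    (s : seq F) (w : F -> V) :
  (forall a u v, U (a *: u + v) = a *: U u + U v) -> uniq s ->
  (forall l, l \in s -> U (w l) = l *: w l) ->
  \sum_(l <- s) w l = 0 -> forall l, l \in s -> w l = 0.
Proof.
move=> linU; elim: s w => [//|a s IH] w /= /andP[a_s us] Uw sum0.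
have U0 : U 0 = 0.
  by have := linU (-1) 0 0; rewrite scaler0 addr0 => ->; rewrite scaleN1r addNr.
have UZ c u : U (c *: u) = c *: U u by rewrite -[c *: u]addr0 linU U0 addr0.
have Usum t : U (\sum_(l <- t) w l) = \sum_(l <- t) U (w l).
  elim: t => [|b t IHt]; first by rewrite !big_nil U0.
  by rewrite !big_cons -[w b]scale1r linU !scale1r IHt.
have ws l : l \in s -> w l = 0.
  move=> ls; have nla : l - a != 0.
    by rewrite subr_eq0; apply: contraNneq a_s => <-.
  have Ew m : m \in s -> U ((m - a) *: w m) = m *: ((m - a) *: w m).
    by move=> ms; rewrite UZ Uw ?inE ?ms ?orbT// !scalerA mulrC.
  (* Applying [U] to the relation and subtracting [a] times it removes [w a] and scales every other
     [w m] by [m - a]. *)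
  have E0 : \sum_(m <- s) (m - a) *: w m = 0.
    have := Usum (a :: s); rewrite sum0 U0 big_cons.
    rewrite (Uw a) ?mem_head// => /esym.
    move: sum0; rewrite big_cons => /eqP; rewrite addr_eq0 => /eqP ->.
    rewrite scalerN scaler_sumr addrC => /eqP; rewrite subr_eq0 => /eqP E.
    under eq_bigr do rewrite scalerBl.
    rewrite sumrB; apply/eqP; rewrite subr_eq0 -E; apply/eqP.
    by apply: eq_big_seq => m ms; rewrite Uw // inE ms orbT.
  have := IH (fun m => (m - a) *: w m) us Ew E0 l ls.
  by move/eqP; rewrite scaler_eq0 (negbTE nla) => /eqP.
move=> l; rewrite inE => /orP[/eqP ->|]; last exact: ws.
by move: sum0; rewrite big_cons big_seq big1 ?addr0.
Qed.

(** [QHT_is] and [HT_is] quantify over all decompositions; this lemma makes their tail probabilities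
    independent of the choice. Both families are extended by zero to a common list, where their
    difference decomposes [0]. *)
Lemma eigen_decomp_unique (F : fieldType) (V : lmodType F) (U : V -> V)
    (M : zmodType) (h : F -> V -> M) (s s' : seq F) (w w' : F -> V) :
  (forall a u v, U (a *: u + v) = a *: U u + U v) ->
  (forall l, h l 0 = 0) -> uniq s -> uniq s' ->
  (forall l, l \in s -> U (w l) = l *: w l) ->
  (forall l, l \in s' -> U (w' l) = l *: w' l) ->
  \sum_(l <- s) w l = \sum_(l <- s') w' l ->
  \sum_(l <- s) h l (w l) = \sum_(l <- s') h l (w' l).
Proof.
move=> linU h0 us us' Uw Uw' Esum.
have U0 : U 0 = 0.
  by have := linU (-1) 0 0; rewrite scaler0 addr0 => ->; rewrite scaleN1r addNr.
have UB u v : U (u - v) = U u - U v.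
  by rewrite addrC -scaleN1r linU scaleN1r addrC.
pose ext (t : seq F) (u : F -> V) l := if l \in t then u l else 0.
pose r := undup (s ++ s').
have extsum t u (M' : zmodType) (g : F -> V -> M') : (forall l, g l 0 = 0) ->
    uniq t -> {subset t <= r} ->
    \sum_(l <- t) g l (u l) = \sum_(l <- r) g l (ext t u l).
  move=> g0 ut tr; rewrite [RHS](bigID (mem t)) /=.
  rewrite [X in _ = _ + X]big1 ?addr0; last first.
    by move=> l /negbTE lt; rewrite /ext lt.
  transitivity (\sum_(l <- r | l \in t) g l (u l)); last first.
    by apply: eq_bigr => l lt; rewrite /ext lt.
  rewrite -[RHS]big_filter; apply/perm_big/uniq_perm; rewrite ?filter_uniq ?undup_uniq//.
  by move=> l; rewrite mem_filter; case: (boolP (l \in t)) => //= /tr.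
have sr : {subset s <= r} by move=> l ls; rewrite mem_undup mem_cat ls.
have sr' : {subset s' <= r} by move=> l ls; rewrite mem_undup mem_cat ls orbT.
rewrite (extsum s) // (extsum s') //; apply: eq_big_seq => l lr.
congr h; apply/eqP; rewrite -subr_eq0; apply/eqP.
apply: (@eigen_sum_eq0 _ _ U r (fun l => ext s w l - ext s' w' l)) => //.
- exact: undup_uniq.
- move=> m _; rewrite UB scalerBr; congr (_ - _).
  + by rewrite /ext; case: ifP => [/Uw//|_]; rewrite scaler0.
  + by rewrite /ext; case: ifP => [/Uw'//|_]; rewrite scaler0.
- rewrite sumrB -(extsum s w V (fun _ v => v)) // -(extsum s' w' V (fun _ v => v)) //.
  by rewrite Esum subrr.
Qed.

(** The spectral theorem is applied over [R[i]]. Since [S] and its eigenvalues are real, the real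
    parts of the complex components of [v] are again eigenvectors. *)
Lemma symmetric_eigen_decomp (R : rcfType) (m : nat) (S : 'M[R]_m) (v : 'cV[R]_m) :
  S^T = S -> exists s w,
    [/\ uniq s, forall l, l \in s -> S *m w l = l *: w l & v = \sum_(l <- s) w l].
Proof.
move=> symS; pose A : 'M[R[i]]_m := map_mx (real_complex R) S.
have hA : A \is hermsymmx.
  apply: realsym_hermsym.
    by apply/is_hermitianmxP; rewrite /= scale1r map_mx_id // map_trmx symS.
  by apply/mxOverP => i j; rewrite mxE; apply/complex_realP; exists (S i j).
have [Q [d [uQ EA]]] : exists (Q : 'M[R[i]]_m) (d : 'rV[R]_m),
    Q \in unitmx /\ A = invmx Q *m diag_mx (map_mx (real_complex R) d) *m Q.
  exists (spectralmx A), (map_mx (@complex.Re R) (spectral_diag A)).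
  split=> //; first exact: spectral_unit.
  have /orthomx_spectralP := hermitian_normalmx hA.
  have /mxOverP rD := hermitian_spectral_diag_real hA.
  move=> {1}->; do 2!congr (_ *m _); congr diag_mx.
  by apply/matrixP => i j; rewrite !mxE; rewrite RRe_real.
pose c i := (Q *m map_mx (real_complex R) v) i 0.
pose u i : 'cV[R[i]]_m := c i *: (invmx Q *m delta_mx i 0).
have Au i : A *m u i = (d 0 i)%:C *: u i.
  rewrite -scalemxAr EA -!mulmxA mulKVmx // scalerA mulrC -scalerA.
  congr (_ *: _); rewrite scalemxAr; congr (_ *m _).
  apply/matrixP => j k; rewrite mul_diag_mx !mxE.
  by case: eqP => [->|]; rewrite ?mulr0.
have vu : map_mx (real_complex R) v = \sum_i u i.
  rewrite -[LHS](mulKmx uQ) [Q *m _]matrix_sum_delta mulmx_sumr.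
  by apply: eq_bigr => i _; rewrite big_ord1 -scalemxAr.
pose ur i : 'cV[R]_m := map_mx (@complex.Re R) (u i).
have Sur i : S *m ur i = d 0 i *: ur i.
  have ReZ (a : R) (b : R[i]) : complex.Re (a%:C * b) = a * complex.Re b.
    by case: b => b b'; rewrite /= mul0r subr0.
  apply/matrixP => j k; have /matrixP/(_ j k) := Au i.
  rewrite [in RHS]mxE => E; rewrite [RHS]mxE [ur i j k]mxE -ReZ -E !mxE raddf_sum.
  by apply: eq_bigr => p _; rewrite [A j p]mxE [ur i p k]mxE; exact: esym (ReZ _ _).
have vur : v = \sum_i ur i.
  apply/matrixP => j k; have /matrixP/(_ j k) := vu.
  rewrite mxE summxE => /(congr1 (@complex.Re R)) /= ->.
  by rewrite raddf_sum summxE; apply: eq_bigr => i _; rewrite [RHS]mxE.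
pose s := undup [seq d 0 i | i : 'I_m].
(* Components with the same eigenvalue are merged, so that the list has no repetition. *)
exists s, (fun l => \sum_(i | d 0 i == l) ur i); split.
- exact: undup_uniq.
- move=> l _; rewrite mulmx_sumr scaler_sumr.
  by apply: eq_bigr => i /eqP <-.
- rewrite (exchange_big_dep predT) //= vur; apply: eq_bigr => i _.
  rewrite -big_filter (perm_big [:: d 0 i]) ?big_seq1//.
  apply: uniq_perm; rewrite ?filter_uniq ?undup_uniq//.
  move=> l; rewrite mem_filter !inE [d 0 i == l]eq_sym; case: eqP => //= ->.
  by rewrite mem_undup; apply/mapP; exists i; rewrite ?mem_enum.
Qed.

Lemma seq_max_exists (R : realDomainType) (s : seq R) (x0 : R) : x0 \in s ->
  exists2 m, m \in s & forall x, x \in s -> x <= m.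
Proof.
elim: s x0 => [//|a s IH] x0 _; case: s IH => [|b s] IH.
  by exists a; rewrite ?mem_head// => x; rewrite inE => /eqP->.
have [m ms mP] := IH b (mem_head _ _).
have [am|/ltW ma] := leP a m.
  exists m; rewrite ?inE 1?orbC -?in_cons ?ms// => x.
  by rewrite inE => /orP[/eqP->//|/mP].
exists a; rewrite ?mem_head// => x.
by rewrite inE => /orP[/eqP->//|/mP/le_trans]; apply.
Qed.

(** * Minimal thresholds of finitely supported tail functions *)

Section Threshold.
Variable R : realType.
Implicit Types (l : seq (R * R)) (eps : R).

(** The tail jumps only at listed values, so the least admissible listed value is the minimum.
    Having [0] in the list guarantees a listed value below any admissible [y]. *)
Lemma exists_min_threshold l eps : 0 <= eps ->
  0 \in map fst l -> (forall y, tail_prob l y <= eps -> 0 <= y) ->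
  exists2 h, 0 <= h & is_min_threshold (tail_prob l) eps h.
Proof.
move=> eps0 l0 Tpos.
pose C := [seq c <- map fst l | tail_prob l c <= eps].
have Cy y : tail_prob l y <= eps -> exists2 c, c \in C & c <= y.
  move=> Ty; have y0 := Tpos _ Ty.
  have [|c] := @seq_max_exists _ [seq c <- map fst l | c <= y] 0.
    by rewrite mem_filter y0.
  rewrite mem_filter => /andP[cy cl] cmax; exists c => //.
  rewrite mem_filter cl andbT (le_trans _ Ty) // le_eqVlt; apply/orP; left.
  apply/eqP; rewrite /tail_prob [LHS]big_seq_cond [RHS]big_seq_cond.
  apply: eq_bigl => p; case: (boolP (p \in l)) => //= pl.
  apply/idP/idP => [cp|]; last exact: le_lt_trans.
  rewrite ltNge; apply/negP => py.
  have := cmax p.1; rewrite mem_filter py map_f // => /(_ isT).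
  by rewrite leNgt cp.
(* At the largest listed value the tail is an empty sum, so [C] is not empty. *)
have [M _ MP] := seq_max_exists l0.
have TM : tail_prob l M <= eps.
  rewrite /tail_prob big_seq_cond big_pred0 // => p.
  by case: (boolP (p \in l)) => //= pl; rewrite ltNge MP ?map_f.
have [c0 c0C _] := Cy _ TM.
have [|m] := @seq_max_exists _ (map -%R C) (- c0); first by rewrite map_f.
case/mapP => h hC -> hmin; exists h.
  by apply: Tpos; move: hC; rewrite mem_filter => /andP[].
split; first by move: hC; rewrite mem_filter => /andP[].
move=> y /Cy[c cC cy]; apply: le_trans cy.
by have := hmin (- c); rewrite map_f // lerN2; apply.
Qed.

Lemma min_threshold_sqrt (T T2 : R -> R) eps h : 0 <= h ->
  (forall y, 0 <= y -> T2 (y ^+ 2) = T y) -> (forall y, T y <= eps -> 0 <= y) ->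
  is_min_threshold T2 eps h -> is_min_threshold T eps (Num.sqrt h).
Proof.
move=> h0 TT2 Tpos [Th hmin]; split; first by rewrite -TT2 ?sqrtr_ge0// sqr_sqrtr.
move=> y Ty; have y0 := Tpos _ Ty.
by rewrite -(ger0_norm y0) -sqrtr_sqr ler_wsqrtr // hmin // TT2.
Qed.

Lemma eq_min_threshold (T T' : R -> R) eps h :
  T =1 T' -> is_min_threshold T eps h -> is_min_threshold T' eps h.
Proof. by move=> TT' [Th hmin]; split=> [|y]; rewrite -TT' //; exact: hmin. Qed.

End Threshold.

(** * Nonnegative matrices and irreducible chains *)

Section Chain.
Variables (R : realType) (n : nat) (P : 'M[R]_n).
Hypothesis P_ge0 : forall x y, 0 <= P x y.

Lemma expmx_ge0 k x y : 0 <= (P ^+ k) x y.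
Proof.
elim: k x y => [|k IH] x y; first by rewrite expr0 mxE ler0n.
by rewrite exprS mxE sumr_ge0 // => i _; rewrite mulr_ge0.
Qed.

Lemma closed_class_reach (C : pred 'I_n) k x y :
  (forall a b, C a -> 0 < P a b -> C b) -> C x -> 0 < (P ^+ k) x y -> C y.
Proof.
move=> closedC; elim: k x y => [|k IH] x y Cx.
  by rewrite expr0 mxE; case: eqP => [<-//|]; rewrite ltxx.
rewrite exprS mxE lt0r => /andP[nz _].
have [w nw] : exists w, P x w * (P ^+ k) w y != 0.
  apply/existsP; move: nz; apply: contraNT; rewrite negb_exists => /forallP E.
  by rewrite big1 // => w _; apply/eqP; move: (E w); rewrite negbK.
move: nw; rewrite mulf_eq0 negb_or => /andP[n1 n2].
by apply: (IH w); rewrite ?lt0r ?n2 ?expmx_ge0 //; apply: closedC Cx _;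
  rewrite lt0r n1 P_ge0.
Qed.

(* Maximum principle: where |g| is maximal the eigenvalue equation forces |g| to
   be maximal at all successors, and irreducibility carries this to [z]. *)
Lemma killed_eigenvalue_lt1 (z : 'I_n) (g : 'I_n -> R) (l : R) :
  (forall x, \sum_y P x y = 1) -> irreducible_chain P -> g z = 0 ->
  (forall x, x != z -> \sum_y P x y * g y = l * g x) ->
  (exists x, g x != 0) -> `|l| < 1.
Proof.
move=> P1 irr gz Eg [x1 gx1]; rewrite ltNge; apply/negP => l1.
have [|M] := @seq_max_exists _ [seq `|g x| | x : 'I_n] `|g z|.
  by apply: map_f; rewrite mem_enum.
case/mapP => x0 _ -> gmax; set M0 := `|g x0| in gmax.
have gM x : `|g x| <= M0 by apply/gmax/map_f; rewrite mem_enum.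
have M0gt : 0 < M0 by rewrite (lt_le_trans _ (gM x1)) // normr_gt0.
have [k Pk] := irr x0 z.
suff /closed_class_reach/(_ (eqxx _) Pk) : forall a b,
    `|g a| == M0 -> 0 < P a b -> `|g b| == M0.
  by rewrite gz normr0 lt_eqF.
move=> a b /eqP ga Pab; have az : a != z.
  by apply: contraTneq M0gt => E; rewrite -ga E gz normr0 ltxx.
(* The chain is [M0 <= |l| M0 = |l g a| <= sum_y P a y |g y|]. The mean of the nonnegative gaps
   [M0 - |g y|] is thus zero, and so is each gap of positive weight. *)
have le0 : \sum_y P a y * (M0 - `|g y|) <= 0.
  under eq_bigr do rewrite mulrBr.
  rewrite sumrB -mulr_suml P1 mul1r subr_le0.
  apply: (@le_trans _ _ `|l * g a|).
    by rewrite normrM ga ler_peMl // ltW.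
  rewrite -Eg //; apply: le_trans (ler_norm_sum _ _ _) _.
  by apply: ler_sum => y _; rewrite normrM (ger0_norm (P_ge0 _ _)).
have t0 y : 0 <= P a y * (M0 - `|g y|) by rewrite mulr_ge0 // subr_ge0.
have /eqP : \sum_y P a y * (M0 - `|g y|) = 0.
  by apply/eqP; rewrite eq_le le0 sumr_ge0.
rewrite psumr_eq0 // => /allP/(_ b); rewrite mem_index_enum => /(_ isT) /=.
by rewrite mulf_eq0 gt_eqF //= subr_eq0 eq_sym.
Qed.

End Chain.

(** * Reversibility and the discriminant of the classical analogue *)

Section Walk.
Variables (R : realType) (n : nat) (phi : 'M[R]_n).
Local Notation C := R[i].
Local Notation P := (classical_analogue phi).

Lemma classical_analogue_ge0 x y : 0 <= P x y.
Proof. by rewrite mxE sqr_ge0. Qed.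

Section Symmetric.
Variable pi : 'I_n -> R.
Hypothesis phi1 : forall x, \sum_y phi x y ^+ 2 = 1.
Hypothesis pi_ge0 : forall x, 0 <= pi x.
Hypothesis phi_sym : forall x y,
  Num.sqrt (pi x) * phi x y = Num.sqrt (pi y) * phi y x.
Hypothesis irr : irreducible_chain P.

(** The support of [pi] is nonempty by normalization and closed under transitions by [phi_sym], so
    irreducibility makes it everything. *)
Lemma stationary_gt0 : dotC (walk_state phi pi) (walk_state phi pi) = 1 ->
  forall x, 0 < pi x.
Proof.
move=> norm1 y.
have [x0 x0n] : exists x, pi x != 0.
  apply/existsP; move: (oner_neq0 C); apply: contraNT.
  rewrite negb_exists => /forallP E; rewrite -norm1 /dotC big1 // => x _.
  rewrite big1 // => w _; rewrite !mxE.
  by move: (E x); rewrite negbK => /eqP ->; rewrite sqrtr0 mul0r mulr0.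
have [k Pk] := irr x0 y; rewrite lt0r pi_ge0 andbT.
apply: (@closed_class_reach _ _ _ classical_analogue_ge0
          (fun x => pi x != 0) k x0) => // a b pa.
rewrite mxE lt0r sqrf_eq0 => /andP[nab _].
have : Num.sqrt (pi a) * phi a b != 0.
  by rewrite mulf_neq0 // gt_eqF // sqrtr_gt0 lt0r pa pi_ge0.
by rewrite phi_sym; apply: contraNneq => ->; rewrite sqrtr0 mul0r.
Qed.

Hypothesis pi_gt0 : forall x, 0 < pi x.

(** By [phi_sym] the factors [phi x y] and [phi y x] never have opposite signs, so this is the usual
    discriminant [sqrt (p_xy p_yx)], blind to the signs of [phi]. *)
Lemma discriminantE x y : phi x y * phi y x =
  Num.sqrt (pi x) * P x y / Num.sqrt (pi y).
Proof.
have ny : Num.sqrt (pi y) != 0 by rewrite gt_eqF ?sqrtr_gt0.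
rewrite mxE expr2 mulrA phi_sym; field; exact: ny.
Qed.

(** Dividing [f] by [sqrt pi] conjugates the discriminant back to [P], where the maximum principle
    applies. *)
Lemma discriminant_eigenvalue_lt1 z (f : 'I_n -> R) l : f z = 0 ->
  (forall x, x != z -> \sum_y phi x y * phi y x * f y = l * f x) ->
  (exists x, f x != 0) -> `|l| < 1.
Proof.
move=> fz Ef [x0 fx0].
have np x : Num.sqrt (pi x) != 0 by rewrite gt_eqF ?sqrtr_gt0.
apply: (@killed_eigenvalue_lt1 _ _ _ classical_analogue_ge0 z
          (fun x => f x / Num.sqrt (pi x))) => //.
- by move=> x; rewrite -[RHS](phi1 x); apply: eq_bigr => y _; rewrite mxE.
- by rewrite fz mul0r.
- move=> x xz; rewrite mulrA -Ef // mulr_suml; apply: eq_bigr => y _.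
  rewrite discriminantE; field; rewrite ?np //.
- by exists x0; rewrite mulf_neq0 // invr_neq0.
Qed.

End Symmetric.

Lemma dotC_conjc (u v : 'M[C]_n) : dotC u v = \sum_x \sum_y conjc (u x y) * v x y.
Proof. by []. Qed.

(** * The search operator and its two-dimensional invariant subspaces *)

Section Search.
Variable z : 'I_n.
Hypothesis phi1 : forall x, \sum_y phi x y ^+ 2 = 1.

Definition search_op (v : 'M[C]_n) : 'M[C]_n :=
  qwalk phi (v - (2 * dotC (local_state phi z) v) *: local_state phi z).

Lemma dot_local_state (v : 'M[C]_n) :
  dotC (local_state phi z) v = \sum_y toC (phi z y) * v z y.
Proof.
rewrite dotC_conjc (bigD1 z) //= [X in _ + X]big1 ?addr0.
  by apply: eq_bigr => y _; rewrite mxE eqxx /toC conjc_real.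
by move=> x /negbTE xz; rewrite big1 // => y _; rewrite mxE xz conjc0 mul0r.
Qed.

Lemma phi1C x : \sum_y toC (phi x y) * toC (phi x y) = 1.
Proof.
rewrite -[RHS](rmorph1 (real_complex R)) -(phi1 x) rmorph_sum.
by apply: eq_bigr => y _; rewrite expr2 rmorphM.
Qed.

(* The two reflections compose to the reflection about the span of the
   [|x>|phi^x>] with [x != z]. *)
Lemma search_opE v x y : search_op v x y =
  if y == z then - v y x
  else 2 * toC (phi y x) * (\sum_t toC (phi y t) * v y t) - v y x.
Proof.
rewrite /search_op /qwalk /SWAP mxE /Fop mxE; case: eqP => [->|yz].
  under eq_bigr => t _.
    rewrite [X in _ * X]mxE [X in _ + X]mxE [X in _ - X]mxE [local_state _ _ _ _]mxE eqxx.
    over.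
  under eq_bigr do rewrite mulrBr.
  rewrite sumrB -dot_local_state; set d := dotC _ _.
  under eq_bigr do rewrite mulrCA.
  rewrite -mulr_sumr phi1C !mxE eqxx; ring.
have muy t : local_state phi z y t = 0 by rewrite mxE; case: eqP.
congr (_ * _ - _); last by rewrite !mxE; case: eqP => // _; rewrite mulr0 subr0.
apply: eq_bigr => t _; rewrite !mxE; case: eqP => // _; by rewrite mulr0 subr0.
Qed.

Lemma search_op_linear a u v :
  search_op (a *: u + v) = a *: search_op u + search_op v.
Proof.
apply/matrixP => x y; rewrite [RHS]mxE [X in _ = X + _]mxE !search_opE.
have -> : (a *: u + v) y x = a * u y x + v y x by rewrite !mxE.
case: eqP => _; first by ring.
have -> : \sum_t toC (phi y t) * (a *: u + v) y t =
    a * (\sum_t toC (phi y t) * u y t) + \sum_t toC (phi y t) * v y t.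
  rewrite mulr_sumr -big_split; apply: eq_bigr => t _; rewrite !mxE /=; ring.
ring.
Qed.

Definition amplitude_mx (f : 'I_n -> R) : 'M[R]_n := \matrix_(x, y) (f x * phi x y).
Local Notation cmx := (map_mx (@toC R)).

Section Eigen.
Variables (f : 'I_n -> R) (l : R).
Hypothesis fz : f z = 0.
Hypothesis Ef : forall x, x != z -> \sum_y phi x y * phi y x * f y = l * f x.
Local Notation A := (amplitude_mx f).

(** Row [x] of [A] is a multiple of [phi^x], hence fixed by the reflection, and row [z] vanishes;
    only SWAP acts. *)
Lemma search_op_amplitude : search_op (cmx A) = cmx A^T.
Proof.
apply/matrixP => x y; rewrite search_opE; case: eqP => [->|_].
  by rewrite !mxE fz mul0r /toC rmorph0 oppr0.
under eq_bigr do rewrite !mxE /toC rmorphM mulrCA.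
rewrite -mulr_sumr phi1C !mxE /toC rmorphM; ring.
Qed.

(** The inner product of [phi^y] with row [y] of [A^T] is the discriminant applied to [f] at [y],
    that is [l * f y]. *)
Lemma search_op_amplitudeT :
  search_op (cmx A^T) = (2 * toC l) *: cmx A^T - cmx A.
Proof.
apply/matrixP => x y; rewrite search_opE; case: eqP => [->|/eqP yz].
  by rewrite !mxE fz mul0r /toC rmorph0 mulr0 add0r.
have -> : \sum_t toC (phi y t) * cmx A^T y t = toC (l * f y).
  rewrite -Ef // /toC rmorph_sum; apply: eq_bigr => t _.
  by rewrite !mxE -rmorphM; congr (_%:C); ring.
rewrite !mxE /toC !rmorphM; ring.
Qed.

Lemma amplitude_norm : \sum_x \sum_y A x y ^+ 2 = \sum_x f x ^+ 2.
Proof.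
apply: eq_bigr => x _; under eq_bigr do rewrite mxE exprMn.
by rewrite -mulr_sumr phi1 mulr1.
Qed.

Lemma amplitude_swap : \sum_x \sum_y A x y * A y x = l * \sum_x f x ^+ 2.
Proof.
rewrite mulr_sumr; apply: eq_bigr => x _.
have [->|xz] := eqVneq x z.
  by rewrite fz expr0n mulr0 big1 // => y _; rewrite mxE fz !mul0r.
rewrite expr2 mulrA -Ef // mulr_suml.
by apply: eq_bigr => y _; rewrite !mxE; ring.
Qed.

End Eigen.

(* For real A, the component of A on the eigenvalue [lam] of the two-dimensional
   space spanned by A and its transpose, on which the search operator maps
   A to A^T and A^T to 2 (Re lam) A^T - A. *)
Definition eigen_component (A : 'M[R]_n) (lam : C) : 'M[C]_n :=
  let l := complex.Re lam in let m := complex.Im lam in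
  (2^-1 +i* (l / (2 * m))) *: cmx A + (0 +i* (- (2 * m)^-1)) *: cmx A^T.

Lemma eigen_component_pair A l m : m != 0 ->
  eigen_component A (l +i* m) + eigen_component A (l +i* (- m)) = cmx A.
Proof.
move=> m0; apply/matrixP => x y; rewrite !mxE /=; apply/eqP; rewrite eq_complex /=.
rewrite !mulrN !invrN; apply/andP; split; apply/eqP; field; exact: m0.
Qed.

(** The squared norm is [(|A|^2 + |A^T|^2 - 2 l <A, A^T>) / (4 m^2)], and the numerator equals
    [2 N (1 - l^2) = 2 N m^2]. *)
Lemma eigen_component_sqnorm (A : 'M[R]_n) (l m N : R) : m != 0 -> l ^+ 2 + m ^+ 2 = 1 ->
  \sum_x \sum_y A x y ^+ 2 = N -> \sum_x \sum_y A x y * A y x = l * N ->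
  sqnormC (eigen_component A (l +i* m)) = N / 2.
Proof.
move=> m0 lm AN AT; rewrite /sqnormC dotC_conjc.
have E x y : complex.Re (conjc (eigen_component A (l +i* m) x y) *
    eigen_component A (l +i* m) x y) =
    (4 * m ^+ 2)^-1 * (A x y ^+ 2 + A y x ^+ 2 - 2 * l * (A x y * A y x)).
  have -> : A x y ^+ 2 = A x y ^+ 2 * (l ^+ 2 + m ^+ 2) by rewrite lm mulr1.
  rewrite !mxE /=; move: (A x y) (A y x) => a b.
  by field.
have -> : complex.Re (\sum_x \sum_y conjc (eigen_component A (l +i* m) x y) *
    eigen_component A (l +i* m) x y) =
    \sum_x \sum_y (4 * m ^+ 2)^-1 *
      (A x y ^+ 2 + A y x ^+ 2 - 2 * l * (A x y * A y x)).
  rewrite raddf_sum; apply: eq_bigr => x _; rewrite raddf_sum.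
  by apply: eq_bigr => y _; rewrite -E.
under eq_bigr do rewrite -mulr_sumr sumrB big_split -mulr_sumr /=.
rewrite -mulr_sumr sumrB big_split -mulr_sumr /= AN AT exchange_big /= AN.
have -> : N + N - 2 * l * (l * N) = 2 * m ^+ 2 * N.
  have -> : m ^+ 2 = 1 - l ^+ 2 by rewrite -lm addrC addKr.
  ring.
by field.
Qed.

(** On the span of [A] and [A^T] the operator satisfies [U^2 - 2 l U + 1 = 0], whose roots are
    [l +- i m]. *)
Lemma search_op_component f (lam : C) :
  complex.Im lam != 0 -> complex.Re lam ^+ 2 + complex.Im lam ^+ 2 = 1 ->
  f z = 0 ->
  (forall x, x != z -> \sum_y phi x y * phi y x * f y = complex.Re lam * f x) ->
  search_op (eigen_component (amplitude_mx f) lam) =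
  lam *: eigen_component (amplitude_mx f) lam.
Proof.
case: lam => l m /= m0 lm fz Ef; rewrite /eigen_component /=.
have opZ a u : search_op (a *: u) = a *: search_op u.
  rewrite -[a *: u]addr0 search_op_linear.
  have := search_op_linear (-1) 0 0; rewrite scaler0 addr0 => ->.
  by rewrite scaleN1r addNr addr0.
rewrite search_op_linear opZ search_op_amplitude // (search_op_amplitudeT fz Ef).
apply/matrixP => x y; rewrite !mxE.
move: (f x * _) (f y * _) => a b.
apply/eqP; rewrite eq_complex /=; apply/andP; split; apply/eqP; first by field.
(* The coefficient of [a] is [1 / (2 m)] on one side and [(l^2 + m^2) / (2 m)] on the other. *)
have aE : a = (l ^+ 2 + m ^+ 2) * a by rewrite lm mul1r.
by rewrite {1}aE; field.
Qed.

End Search.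

(** * The matrix [S_{-z}], the starting state and the tail formulas *)

Section Hitting.
Variables (pi : 'I_n -> R) (z : 'I_n).
Hypothesis phi1 : forall x, \sum_y phi x y ^+ 2 = 1.
Hypothesis pi_gt0 : forall x, 0 < pi x.
Hypothesis phi_sym : forall x y,
  Num.sqrt (pi x) * phi x y = Num.sqrt (pi y) * phi y x.

Definition extend0 (v : 'cV[R]_n.-1) (x : 'I_n) : R :=
  oapp (fun i => v i 0) 0 (unlift z x).

Lemma extend0_z v : extend0 v z = 0.
Proof. by rewrite /extend0 unlift_none. Qed.

Lemma extend0_lift v i : extend0 v (lift z i) = v i 0.
Proof. by rewrite /extend0 liftK. Qed.

Lemma extend0_sqnorm v : \sum_x extend0 v x ^+ 2 = sqnormR v.
Proof.
rewrite (bigD1_ord z) //= extend0_z expr0n add0r.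
by apply: eq_bigr => i _; rewrite extend0_lift.
Qed.

Lemma S_minusE i j : S_minus P pi z i j =
  phi (lift z i) (lift z j) * phi (lift z j) (lift z i).
Proof.
have np x : Num.sqrt (pi x) != 0 by rewrite gt_eqF ?sqrtr_gt0.
(* An explicit inverse stands in for [invmx], so that entries can be computed. *)
pose D' : 'M[R]_n.-1 := diag_mx (\row_i (Num.sqrt (pi (lift z i)))^-1).
have DD' : sqrtPi_minus pi z *m D' = 1%:M.
  apply/matrixP => a b; rewrite mul_diag_mx !mxE.
  by case: eqP => _; rewrite ?mulr0 // mulr1n mulfV.
have [uD _] := mulmx1_unit DD'.
have -> : S_minus P pi z = sqrtPi_minus pi z *m P_minus P z *m D'.
  by rewrite /S_minus -[D'](mulKmx uD) DD' mulmx1.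
by rewrite mul_mx_diag mul_diag_mx !mxE (discriminantE phi_sym) // mxE.
Qed.

Lemma S_minus_sym : (S_minus P pi z)^T = S_minus P pi z.
Proof. by apply/matrixP => i j; rewrite mxE !S_minusE mulrC. Qed.

Lemma S_minus_eigen v l : S_minus P pi z *m v = l *: v ->
  forall x, x != z -> \sum_y phi x y * phi y x * extend0 v y = l * extend0 v x.
Proof.
move=> Ev x xz; have [i -> {x xz}] : exists i, x = lift z i.
  by case: (unliftP z x) xz => [i ->|->]; [exists i | rewrite eqxx].
have /matrixP/(_ i 0) := Ev; rewrite !mxE extend0_lift => <-.
rewrite (bigD1_ord z) //= extend0_z mulr0 add0r.
by apply: eq_bigr => j _; rewrite extend0_lift S_minusE.
Qed.

Lemma tail_prob_H y s (w : R -> 'cV[R]_n.-1) : tail_prob (H_distr s w) y =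
  (if y < 0 then 1 - \sum_(l <- s) sqnormR (w l) else 0) +
  \sum_(l <- s) (if y < (acos l ^+ 2)^-1 then sqnormR (w l) else 0).
Proof.
rewrite /tail_prob big_cons /= big_map -big_mkcond /=.
by case: ifP => _; rewrite ?add0r.
Qed.

(** With the conditions inside the sums, each summand is a function of [l] and [w l] vanishing at
    [w l = 0], as [eigen_decomp_unique] requires. *)
Lemma tail_prob_QH y s (w : C -> 'M[C]_n) : tail_prob (QH_distr s w) y =
  (if y < 0 then 1 - \sum_(l <- s) (if l != 1 then sqnormC (w l) else 0) else 0) +
  \sum_(l <- s) (if (l != 1) && (y < (eig_angle l)^-1) then sqnormC (w l) else 0).
Proof.
rewrite /tail_prob big_cons /= big_map big_filter_cond -!big_mkcond /=.
by case: ifP => _; rewrite ?add0r.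
Qed.

(** The overlap with the marked state is [sqrt (pi z)], so the subtraction erases exactly row
    [z]. *)
Lemma search_start_state :
  walk_state phi pi - dotC (local_state phi z) (walk_state phi pi) *: local_state phi z
  = map_mx (@toC R) (amplitude_mx (extend0 (sqrtpi_minus pi z))).
Proof.
have -> : dotC (local_state phi z) (walk_state phi pi) = toC (Num.sqrt (pi z)).
  rewrite dot_local_state -[RHS]mulr1 -(phi1C phi1 z) mulr_sumr.
  by apply: eq_bigr => y _; rewrite mxE /toC rmorphM mulrCA.
apply/matrixP => x y; rewrite !mxE; case: (unliftP z x) => [i ->|->].
  rewrite extend0_lift mxE eq_sym (negbTE (neq_lift _ _)) mulr0 subr0.
  by [].
by rewrite extend0_z eqxx mul0r /toC rmorphM rmorph0 subrr.
Qed.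

(** * From a decomposition for [S_{-z}] to one for the search operator *)

Section Decomp.
Variables (s : seq R) (w : R -> 'cV[R]_n.-1).
Hypothesis dec : cdecomp (S_minus P pi z) (sqrtpi_minus pi z) s w.
Hypothesis s_lt1 : forall l, l \in s -> `|l| < 1.

(** For [l = cos theta] this is [sin theta], the imaginary part of [e^(i theta)]. *)
Let sn (l : R) : R := Num.sqrt (1 - l ^+ 2).

Let sn_gt0 l : l \in s -> 0 < sn l.
Proof.
move/s_lt1 => l1; rewrite sqrtr_gt0 subr_gt0 -real_normK ?num_real //.
by rewrite expr_lt1.
Qed.

Let sn_sqr l : l \in s -> l ^+ 2 + sn l ^+ 2 = 1.
Proof.
move=> ls; rewrite sqr_sqrtr ?subrKC // ltW // -sqrtr_gt0; exact: sn_gt0.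
Qed.

Definition search_spectrum : seq C :=
  [seq l +i* sn l | l <- s] ++ [seq l +i* (- sn l) | l <- s].

Definition search_component (lam : C) : 'M[C]_n :=
  eigen_component (amplitude_mx (extend0 (w (complex.Re lam)))) lam.

Lemma search_spectrumP lam : lam \in search_spectrum ->
  [/\ complex.Re lam \in s, complex.Im lam != 0 &
      complex.Re lam ^+ 2 + complex.Im lam ^+ 2 = 1].
Proof.
rewrite mem_cat => /orP[] /mapP[l ls ->] /=; split; rewrite ?sqrrN ?sn_sqr //.
  by rewrite gt_eqF ?sn_gt0.
by rewrite oppr_eq0 gt_eqF ?sn_gt0.
Qed.

Lemma search_qdecomp V2 : V2 =1 qwalk phi ->
  qdecomp (fun v => V2 (v - (2 * dotC (local_state phi z) v) *: local_state phi z))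
    (walk_state phi pi - dotC (local_state phi z) (walk_state phi pi) *: local_state phi z)
    search_spectrum search_component.
Proof.
move=> V2E; have [us [Sw vE]] := dec; split; [|split].
- rewrite cat_uniq !map_inj_uniq ?us; [|by move=> a b []..].
  (* The two halves are disjoint: their imaginary parts have opposite strict signs. *)
  rewrite /= andbT; apply/hasPn => _ /mapP[l ls ->]; apply/mapP => -[k ks [lk]].
  rewrite lk => /eqP; rewrite eqNr; exact/negP/lt0r_neq0/sn_gt0.
- move=> lam /search_spectrumP[ls m0 lm]; rewrite V2E.
  by apply: search_op_component => //; [exact: extend0_z | exact/S_minus_eigen/Sw].
- rewrite search_start_state /search_spectrum big_cat !big_map /= -big_split /=.
  under eq_big_seq => l ls do
    rewrite /search_component /= eigen_component_pair ?gt_eqF ?sn_gt0 //.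
  apply/matrixP => x y; rewrite summxE !mxE.
  have -> : extend0 (sqrtpi_minus pi z) x = \sum_(l <- s) extend0 (w l) x.
    rewrite vE; case: (unliftP z x) => [i ->|->].
      by rewrite extend0_lift summxE; apply: eq_bigr => l _; rewrite extend0_lift.
    by rewrite extend0_z big1 // => l _; rewrite extend0_z.
  rewrite mulr_suml /toC rmorph_sum; apply: eq_bigr => l _.
  by rewrite !mxE.
Qed.

Lemma search_component_sqnorm lam : lam \in search_spectrum ->
  sqnormC (search_component lam) = sqnormR (w (complex.Re lam)) / 2.
Proof.
have [_ [Sw _]] := dec.
case: lam => l m /search_spectrumP[/= ls m0 lm].
apply: eigen_component_sqnorm => //; first by rewrite amplitude_norm // extend0_sqnorm.
by rewrite -extend0_sqnorm (amplitude_swap (extend0_z _) (S_minus_eigen (Sw _ ls))).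
Qed.

(** Each [l] occurs twice, as [e^(i theta)] and [e^(-i theta)], and the two halves add up. *)
Lemma search_spectrum_sum (g : C -> R) (k : R -> R) :
  (forall lam, lam \in search_spectrum -> g lam = k (complex.Re lam) / 2) ->
  \sum_(lam <- search_spectrum) g lam = \sum_(l <- s) k l.
Proof.
move=> gk; rewrite (eq_big_seq _ gk) /search_spectrum big_cat !big_map /= -big_split /=.
by apply: eq_bigr => l _; rewrite -splitr.
Qed.

Lemma search_spectrum_neq1 lam : lam \in search_spectrum -> lam != 1.
Proof.
by case/search_spectrumP => _ + _; apply: contraNneq => ->.
Qed.

Let acos_gt0s l : l \in s -> 0 < acos l.
Proof.
by move/s_lt1; rewrite ltr_norml => /andP[l1 l2]; rewrite acos_gt0 // (ltW l1).
Qed.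

Lemma tail_prob_search y :
  tail_prob (QH_distr search_spectrum search_component) y =
  (if y < 0 then 1 - \sum_(l <- s) sqnormR (w l) else 0) +
  \sum_(l <- s) (if y < (acos l)^-1 then sqnormR (w l) else 0).
Proof.
rewrite tail_prob_QH; congr ((if _ then 1 - _ else _) + _);
  apply: search_spectrum_sum => lam lams.
  by rewrite search_spectrum_neq1 // search_component_sqnorm.
rewrite search_spectrum_neq1 //= search_component_sqnorm // /eig_angle.
by case: ifP => //; rewrite mul0r.
Qed.

(** The atoms at [0] do not count for [y >= 0], and [y < 1 / theta] is equivalent to
    [y^2 < 1 / theta^2]. *)
Lemma tail_prob_sqr y : 0 <= y -> tail_prob (H_distr s w) (y ^+ 2) =
  tail_prob (QH_distr search_spectrum search_component) y.
Proof.
move=> y0; rewrite tail_prob_H tail_prob_search !ltNge sqr_ge0 y0 /=; congr (_ + _).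
apply: eq_big_seq => l ls; congr (if _ then _ else _).
have t0 : 0 <= (acos l)^-1 by rewrite invr_ge0 ltW ?acos_gt0s.
by rewrite -exprVn ltr_pXn2r.
Qed.

Lemma tail_prob_search_neg y : y < 0 ->
  tail_prob (QH_distr search_spectrum search_component) y = 1.
Proof.
move=> y0; rewrite tail_prob_search y0 -[RHS](subrK (\sum_(l <- s) sqnormR (w l))); congr (_ + _).
apply: eq_big_seq => l ls; rewrite (lt_trans y0) // invr_gt0; exact: acos_gt0s.
Qed.

Lemma tail_prob_H_neg y : y < 0 -> tail_prob (H_distr s w) y = 1.
Proof.
move=> y0; rewrite tail_prob_H y0 -[RHS](subrK (\sum_(l <- s) sqnormR (w l))); congr (_ + _).
apply: eq_big_seq => l ls; rewrite (lt_trans y0) // invr_gt0 exprn_gt0 //.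
exact: acos_gt0s.
Qed.

Lemma HT_exists eps : 0 < eps < 1 -> exists2 h, 0 <= h & HT_is P pi z eps h.
Proof.
case/andP => eps0 eps1.
have [||y|h h0 hP] := @exists_min_threshold _ (H_distr s w) eps.
- exact: ltW.
- by rewrite inE eqxx.
- move=> Ty; rewrite leNgt; apply/negP => y0; move: Ty.
  by rewrite tail_prob_H_neg // leNgt eps1.
exists h => //; split; first by exists s, w.
move=> s' w' [us' [Sw' vE']]; have [us [Sw vE]] := dec.
apply: eq_min_threshold hP => y; rewrite !tail_prob_H.
have sq0 : sqnormR (0 : 'cV[R]_n.-1) = 0.
  by rewrite /sqnormR big1 // => i _; rewrite mxE expr0n.
have lin a (u v : 'cV[R]_n.-1) : S_minus P pi z *m (a *: u + v) =
    a *: (S_minus P pi z *m u) + S_minus P pi z *m v.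
  by rewrite mulmxDr scalemxAr.
congr ((if _ then 1 - _ else _) + _).
  by apply: (eigen_decomp_unique (h := fun _ => @sqnormR R n) lin) => //; rewrite -vE.
apply: (eigen_decomp_unique (U := mulmx (S_minus P pi z))
  (h := fun l v => if y < (acos l ^+ 2)^-1 then @sqnormR R n v else 0)) => //.
  by move=> l; case: ifP.
by rewrite -vE.
Qed.

(** [V2] is only pointwise equal to [qwalk phi], so that the lemma also covers [V2P]. *)
Lemma QHT_is_sqrt V2 eps h : V2 =1 qwalk phi -> eps < 1 -> 0 <= h ->
  HT_is P pi z eps h ->
  QHT_is V2 (walk_state phi pi) (local_state phi z) eps (Num.sqrt h).
Proof.
move=> V2E eps1 h0 [_ /(_ s w dec) hP]; have qdec := search_qdecomp V2E.
split; first by exists search_spectrum, search_component.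
move=> s' w' [us' [Uw' vE']]; have [us [Uw vE]] := qdec.
apply: (@eq_min_threshold _ (tail_prob (QH_distr search_spectrum search_component))).
  move=> y; rewrite !tail_prob_QH.
  have sq0 : sqnormC (0 : 'M[C]_n) = 0.
    by rewrite /sqnormC /dotC big1 // => i _; rewrite big1 // => j _; rewrite mxE mulr0.
  have lin a (u v : 'M[C]_n) := search_op_linear z phi1 a u v.
  have Ul l : l \in search_spectrum -> search_op z (search_component l) =
      l *: search_component l by move/Uw; rewrite V2E.
  have Ul' l : l \in s' -> search_op z (w' l) = l *: w' l by move/Uw'; rewrite V2E.
  congr ((if _ then 1 - _ else _) + _).
    apply: (eigen_decomp_unique (h := fun l v => if l != 1 then @sqnormC R n v else 0)
      lin) => //; last by rewrite -vE.
    by move=> l; case: ifP.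
  apply: (eigen_decomp_unique (h := fun l v =>
    if (l != 1) && (y < (eig_angle l)^-1) then @sqnormC R n v else 0) lin) => //.
    by move=> l; case: ifP.
  by rewrite -vE.
apply: min_threshold_sqrt h0 tail_prob_sqr _ hP => y Ty.
rewrite leNgt; apply/negP => y0; move: Ty.
by rewrite tail_prob_search_neg // leNgt eps1.
Qed.

End Decomp.

Lemma S_minus_decomp : irreducible_chain P ->
  exists s w, cdecomp (S_minus P pi z) (sqrtpi_minus pi z) s w /\
    forall l, l \in s -> `|l| < 1.
Proof.
move=> irr.
have [s [w [us Sw vE]]] := symmetric_eigen_decomp (sqrtpi_minus pi z) S_minus_sym.
(* Zero components are dropped, because the bound on [l] needs a genuine eigenvector. *)
exists [seq l <- s | w l != 0], w; split; [split; [|split]|].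
- exact: filter_uniq.
- by move=> l; rewrite mem_filter => /andP[_ /Sw].
- rewrite vE big_filter [RHS]big_mkcond; apply: eq_bigr => l _.
  by case: eqP => // ->.
move=> l; rewrite mem_filter => /andP[wl0 /Sw Swl].
apply: (discriminant_eigenvalue_lt1 phi1 phi_sym irr pi_gt0 (extend0_z (w l))
  (S_minus_eigen Swl)).
have [i wi] : exists i, w l i 0 != 0.
  apply/existsP; move: wl0; apply: contraNT; rewrite negb_exists => /forallP E.
  by apply/eqP/colP => i; rewrite mxE; apply/eqP; move: (E i); rewrite negbK.
by exists (lift z i); rewrite extend0_lift.
Qed.

End Hitting.
End Walk.

(** * The walk built from [P] as the walk of the entrywise absolute value of [phi] *)

Section ClassicalAnalogue.
Variables (R : realType) (n : nat) (phi : 'M[R]_n).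
Local Notation P := (classical_analogue phi).
Local Notation absphi := (map_mx Num.norm phi).

Lemma classical_analogue_abs : classical_analogue absphi = P.
Proof. by apply/matrixP => x y; rewrite !mxE real_normK ?num_real. Qed.

Lemma Avec_local_state x : Avec P x = local_state absphi x.
Proof. by apply/matrixP => x' y; rewrite !mxE sqrtr_sqr. Qed.

Lemma V2P_qwalk : V2P P =1 qwalk absphi.
Proof.
move=> v; congr SWAP; apply/matrixP => x y; rewrite [RHS]mxE [LHS]mxE.
rewrite [X in X + _ = _]mxE [X in _ + X = _]mxE; congr (_ - _).
rewrite /projA summxE (bigD1 x) //= big1 ?addr0; last first.
  move=> x' x'x; rewrite mxE Avec_local_state [X in _ * X]mxE.
  by rewrite eq_sym (negbTE x'x) mulr0.
rewrite mxE Avec_local_state dot_local_state [X in _ * (_ * X) = _]mxE eqxx.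
by rewrite -mulrA; congr (_ * _); rewrite mulrC.
Qed.

Lemma varphiP_walk_state pi : varphiP P pi = walk_state absphi pi.
Proof.
apply/matrixP => x y; rewrite /varphiP summxE (bigD1 x) //= big1 ?addr0.
  by rewrite Avec_local_state !mxE eqxx /toC rmorphM.
move=> x' x'x; rewrite mxE Avec_local_state [X in _ * X]mxE.
by rewrite eq_sym (negbTE x'x) mulr0.
Qed.

End ClassicalAnalogue.

Theorem theorem10 (R : realType) (n : nat) (e : rel 'I_n)
    (phi : 'M[R]_n) (pi : 'I_n -> R) :
  (* G = (X, E) undirected *)
  (forall x y, e x y = e y x) ->
  (* the |phi^x> are real unit vectors supported on the neighbourhood of x *)
  (forall x y, ~~ e x y -> phi x y = 0) ->
  (forall x, \sum_y phi x y ^+ 2 = 1) ->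
  (forall x, 0 <= pi x) ->
  (* |phi_0> = sum_x sqrt(pi_x)|x>|phi^x> is a unit 1-eigenvector of U_2 *)
  dotC (walk_state phi pi) (walk_state phi pi) = 1 ->
  qwalk phi (walk_state phi pi) = walk_state phi pi ->
  (* U_2 is a unitary on a subspace K of H(G) with a single 1-eigenvector *)
  (exists K : 'M[R[i]]_n -> Prop,
      subspace K /\ (forall v, K v -> in_HG e v) /\
      (forall v, K v -> K (qwalk phi v)) /\
      K (walk_state phi pi) /\ (forall x, K (local_state phi x)) /\
      (forall v, K v -> qwalk phi v = v -> exists c : R[i], v = c *: walk_state phi pi)) ->
  (* reversibility *)
  SWAP (walk_state phi pi) = walk_state phi pi ->
  (* the classical analogue P is ergodic with all eigenvalues positive *)
  ergodic (classical_analogue phi) ->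
  (forall l : R[i], eigenvalue (map_mx (@toC R) (classical_analogue phi)) l -> 0 < l) ->
  forall (z : 'I_n) (eps : R), 0 < eps < 1 ->
  exists q h : R,
    QHT_is (qwalk phi) (walk_state phi pi) (local_state phi z) eps q /\
    QHT_P_is (classical_analogue phi) pi z eps q /\
    HT_is (classical_analogue phi) pi z eps h /\
    q = Num.sqrt h.
Proof.
move=> _ _ phi1 pi_ge0 norm1 _ _ swap0 [irr _] _ z eps /andP[eps0 eps1].
have phi_sym x y : Num.sqrt (pi x) * phi x y = Num.sqrt (pi y) * phi y x.
  have /matrixP/(_ y x) := swap0; rewrite !mxE; exact: (@complexI R).
have pi_gt0 := stationary_gt0 pi_ge0 phi_sym irr norm1.
have [s [w [dec s1]]] := S_minus_decomp z phi1 pi_gt0 phi_sym irr.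
have [|h h0 hP] := HT_exists dec s1 (eps := eps); first by rewrite eps0.
exists (Num.sqrt h), h; split; [|split=> //].
  exact: (QHT_is_sqrt phi1 pi_gt0 phi_sym dec s1 (fun=> erefl)).
rewrite /QHT_P_is varphiP_walk_state Avec_local_state.
have abs1 x : \sum_y map_mx Num.norm phi x y ^+ 2 = 1.
  by rewrite -[RHS](phi1 x); apply: eq_bigr => y _; rewrite mxE real_normK ?num_real.
have abs_sym x y : Num.sqrt (pi x) * map_mx Num.norm phi x y =
    Num.sqrt (pi y) * map_mx Num.norm phi y x.
  rewrite !mxE -[Num.sqrt (pi x)]ger0_norm ?sqrtr_ge0 // -normrM phi_sym.
  by rewrite normrM ger0_norm ?sqrtr_ge0.
(* [phi] and its absolute value have the same classical analogue, so the same decomposition and the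
   same [h] serve both walks. *)
rewrite -classical_analogue_abs in dec hP.
exact: (QHT_is_sqrt abs1 pi_gt0 abs_sym dec s1 (@V2P_qwalk _ _ phi)).
Qed.
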